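(* Let $n\ge 2$ and let $f(t)=c\prod_{i=1}^n (t-a_i)$ be a univariate polynomial of degree $n$, where $c$ is a nonzero real constant and the roots $a_1,\dots,a_n$ are regarded as indeterminates. Then the discriminant (with respect to $t$) of the derivative $f'(t)$ is a sum of squares of polynomials, with real coefficients, in the differences $a_i-a_j$ ($1\le i,j\le n$) of the roots of $f(t)$.
   Context: The discriminant of a polynomial of degree $m$ with leading coefficient $\ell$ and roots $r_1,\dots,r_m$ is $\ell^{2m-2}\prod_{i<j}(r_i-r_j)^2$. *)

(* Defs.v *)
From HB Require Import structures.
From mathcomp Require Import all_boot all_order all_algebra.
From mathcomp Require Import reals mpoly.

Set Implicit Arguments.
Unset Strict Implicit.
Unset Printing Implicit Defensive.

Import Order.TTheory GRing.Theory Num.Theory.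
Local Open Scope ring_scope.

Definition splits_with (A : idomainType) (L : fieldType)
    (iota : {rmorphism A -> L}) (p : {poly A}) (r : seq L) : Prop :=
  map_poly iota p = iota (lead_coef p) *: \prod_(z <- r) ('X - z%:P).

Definition disc_of_roots (L : fieldType) (l : L) (r : seq L) : L :=
  l ^+ (2 * size r - 2) *
  \prod_(j < size r) \prod_(i < j) (r`_i - r`_j) ^+ 2.

(* The roots live in a field L containing A.  The first conjunct rules out   *)
(* that the second one holds vacuously; together they determine d (see       *)
(* [is_discriminant_uniq]).  The exponent 2m - 2 is truncated, so this is    *)
(* the usual discriminant for polynomials p of degree m >= 1 only.           *)
Definition is_discriminant (A : idomainType) (p : {poly A}) (d : A) : Prop :=
  (exists (L : fieldType) (iota : {rmorphism A -> L}) (r : seq L),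
      injective iota /\ splits_with iota p r) /\
  (forall (L : fieldType) (iota : {rmorphism A -> L}) (r : seq L),
      injective iota -> splits_with iota p r ->
      iota d = disc_of_roots (iota (lead_coef p)) r).

Lemma is_discriminant_uniq (A : idomainType) (p : {poly A}) (d e : A) :
  is_discriminant p d -> is_discriminant p e -> d = e.
Proof.
move=> [[L [iota [r [inj_iota pr]]]] dP] [_ eP].
by apply: (inj_iota d e); rewrite (dP L iota r) // (eP L iota r).
Qed.

(* The roots a_i are the variables 'X_i of {mpoly R[n]}. *)
Definition generic_poly (R : realType) (n : nat) (c : R) :
    {poly {mpoly R[n]}} :=
  c%:MP *: \prod_(i < n) ('X - ('X_i)%:P).

(* All the a_i - a_j, listed along the enumeration of the pairs (i, j), so   *)
(* that a polynomial in the differences is q \mPo root_differences R n.      *)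
Definition root_differences (R : realType) (n : nat) :
    #|{: 'I_n * 'I_n}|.-tuple {mpoly R[n]} :=
  [tuple 'X_(enum_val k).1 - 'X_(enum_val k).2 | k < #|{: 'I_n * 'I_n}|].

(* Main.v *)
Require Import Defs.
From HB Require Import structures.
From mathcomp Require Import all_boot all_order all_algebra.
From mathcomp Require Import all_fingroup all_field.
From mathcomp Require Import boolp reals mpoly.

(* Let P = 1 - J/n (J the all-ones matrix) be the orthogonal projection onto
   the hyperplane of vectors with zero sum, and let D = diag(b_1, ..., b_n).
   A rank-one update of the determinant gives char_poly (D P) = t g'(t) / n,
   where g is the monic polynomial with roots b_i.  Hence tr (P (D P)^k) is the
   k-th power sum of the roots r_1, ..., r_(n-1) of g'.  As the matrices
   S_k = P (D P)^k are symmetric and S_i S_j = S_(i+j), the Vandermonde identity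
   identifies prod_(i<j) (r_i - r_j)^2 with the Gram determinant of
   S_0, ..., S_(n-2), which is a sum of squares of minors by Cauchy-Binet.
   Taking for b_i the roots a_i of f translated by one of them changes no
   difference of roots of the derivative and makes these minors polynomials in
   the differences of the a_i. *)

Set Implicit Arguments.
Unset Strict Implicit.
Unset Printing Implicit Defensive.

Import Order.TTheory GRing.Theory Num.Theory.
Local Open Scope ring_scope.

(** * Splitting fields *)

Lemma exists_irreducible_divisor (F : fieldType) (p : {poly F}) :
  (1 < size p)%N -> exists2 r, irreducible_poly r & r %| p.
Proof.
elim: {p}(size p).+1 {-2}p (ltnSn (size p)) => // n IHn p.
rewrite ltnS => pn p1.
(* Irreducibility need not be decidable over [F], so the case split is classical. *)
have [irr_p|] := pselect (irreducible_poly p); first by exists p.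
move=> red_p; have p_neq0 : p != 0 by rewrite -size_poly_gt0 ltnW.
have [q [q1 qp nqp]] :
    exists q : {poly F}, [/\ size q != 1, q %| p & ~~ (q %= p)].
  apply: contrapT => noq; apply: red_p; split=> // q q1 qp.
  by apply: contrapT => /negP nqp; apply: noq; exists q.
have q_neq0 := dvdpN0 qp p_neq0.
have [||r irr_r rq] := IHn q.
- apply: leq_trans pn; rewrite ltn_neqAle dvdp_leq // andbT.
  by rewrite dvdp_size_eqp.
- by rewrite ltn_neqAle eq_sym q1 size_poly_gt0.
by exists r => //; apply: dvdp_trans rq qp.
Qed.

(** A root of an irreducible factor is adjoined, and the induction continues with the smaller
    cofactor [u] over the larger field. *)
Lemma exists_splitting_extension (F : fieldType) (p : {poly F}) : p != 0 ->
  exists (L : fieldType) (iota : {rmorphism F -> L}) (r : seq L),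
    map_poly iota p = iota (lead_coef p) *: \prod_(z <- r) ('X - z%:P).
Proof.
move: {2}_.+1 (ltnSn (size p)) => n; elim: n => // n IHn in F p *.
rewrite ltnS => pn p_neq0; have [p1|p1] := leqP (size p) 1.
  exists F, idfun, [::]; rewrite map_poly_id // big_nil alg_polyC.
  by rewrite (size1_polyC p1) lead_coefC.
have [q irr_q qp] := exists_irreducible_divisor p1.
have [K _ [x qx0 _]] := irredp_FAdjoin irr_q.
have /factor_theorem[u pu] : root (map_poly (in_alg K) p) x.
  by rewrite -(divpK qp) rmorphM rootM qx0 orbT.
have u_neq0 : u != 0.
  apply: contra_neq p_neq0 => u0; apply: (map_poly_inj (in_alg K)).
  by rewrite pu u0 mul0r rmorph0.
have lu : lead_coef u = in_alg K (lead_coef p).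
  by rewrite -lead_coef_map pu lead_coef_Mmonic ?monicXsubC.
have [|L [iota [r ur]]] := IHn K u _ u_neq0.
  apply: leq_trans pn.
  rewrite -(size_map_poly (in_alg K)) pu size_Mmonic ?monicXsubC //.
  by rewrite size_XsubC addn2.
exists L, (iota \o in_alg K), (rcons r (iota x)).
rewrite map_poly_comp /= pu rmorphM /= ur map_polyXsubC lu -cats1 big_cat /=.
by rewrite big_seq1 scalerAl.
Qed.

(** * Traces of matrix powers as power sums *)

Lemma char_poly_conj (R : comUnitRingType) n (Q A : 'M[R]_n) : Q \in unitmx ->
  char_poly (Q *m A *m invmx Q) = char_poly A.
Proof.
move=> uQ; rewrite /char_poly /char_poly_mx.
have -> : 'X%:M - map_mx polyC (Q *m A *m invmx Q) =
    map_mx polyC Q *m ('X%:M - map_mx polyC A) *m map_mx polyC (invmx Q).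
  rewrite mulmxBr mulmxBl mul_mx_scalar -scalemxAl -!map_mxM mulmxV //.
  by rewrite map_mx1 scalemx1.
by rewrite !det_mulmx mulrAC -det_mulmx -map_mxM mulmxV // map_mx1 det1 mul1r.
Qed.

Lemma char_poly_block_mx11 (L : fieldType) n (a : L) (u : 'cV_n) (B : 'M[L]_n) :
  char_poly (block_mx a%:M 0 u B) = ('X - a%:P) * char_poly B.
Proof.
rewrite /char_poly /char_poly_mx map_block_mx (scalar_mx_block 1 n) opp_block_mx.
rewrite add_block_mx map_mx0 subr0 det_lblock map_scalar_mx -raddfB.
by rewrite det_scalar1.
Qed.

(* An eigenvector makes A similar to a block triangular matrix. *)
Lemma mxtrace_exp_split (L : fieldType) n (A : 'M[L]_n) (r : seq L) k :
  char_poly A = \prod_(z <- r) ('X - z%:P) ->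
  \tr (iter k (mulmx A) 1%:M) = \sum_(z <- r) z ^+ k.
Proof.
elim: n A r => [|n IHn] A r Ar.
  have /size0nil-> : size r = 0%N.
    by apply: succn_inj; rewrite -(size_prod_XsubC r id) -Ar size_char_poly.
  by rewrite big_nil /mxtrace big_ord0.
case: r Ar => [/(congr1 (size \o polyseq))|z r Ar].
  by rewrite /= size_char_poly big_nil size_poly1.
have /eigenvalueP[v vA v_neq0] : eigenvalue A z.
  by rewrite eigenvalue_root_char Ar big_cons rootM root_XsubC eqxx.
(* [row_ebase v] is invertible and [v] is a nonzero multiple of its first row, so that row is an
   eigenvector too. *)
pose Q : 'M_(1 + n) := row_ebase v.
have uQ : Q \in unitmx by exact: row_ebase_unit.
have QA : row 0 Q *m A = z *: row 0 Q.
  have vQ : v = col_ebase v 0 0 *: row 0 Q.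
    rewrite -{1}[v]mulmx_ebase rank_rV v_neq0 {1}[col_ebase v]mx11_scalar.
    rewrite -mulmxA mul_scalar_mx; congr (_ *: _).
    rewrite rowE; congr (_ *m _); apply/matrixP => i j.
    by rewrite !mxE ord1; case: j => [[]].
  have c_neq0 : col_ebase v 0 0 != 0.
    by apply: contra_neq v_neq0 => c0; rewrite vQ c0 scale0r.
  apply: (scalerI c_neq0).
  by rewrite scalemxAl -vQ vA [in LHS]vQ !scalerA mulrC.
pose B := Q *m A *m invmx Q.
have row0B : row 0 B = z *: row 0 1%:M.
  by rewrite row_mul row_mul QA -scalemxAl -row_mul mulmxV.
have defB : B = block_mx z%:M 0 (dlsubmx B) (drsubmx B).
  move: (B : 'M_(1 + n)) row0B => {}B row0B.
  rewrite -[LHS]submxK; congr block_mx; apply/matrixP => i j;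
    rewrite !ord1 !mxE.
    have /rowP/(_ 0) := row0B; rewrite !mxE eqxx mulr1 mulr1n => <-.
    by congr (B _ _); apply: val_inj.
  have /rowP/(_ (rshift 1 j)) := row0B; rewrite !mxE mulr0 => <-.
  by congr (B _ _); apply: val_inj.
have trB : \tr (iter k (mulmx A) 1%:M) = \tr (iter k (mulmx B) 1%:M).
  have -> : iter k (mulmx B) 1%:M = Q *m iter k (mulmx A) 1%:M *m invmx Q.
    elim: (k) => [|j IHj] /=; first by rewrite mulmx1 mulmxV.
    by rewrite IHj !mulmxA mulmxKV.
  by rewrite mxtrace_mulC mulmxA mulVmx // mul1mx.
have powB : exists u, iter k (mulmx B) 1%:M =
    block_mx (z ^+ k)%:M 0 u (iter k (mulmx (drsubmx B)) 1%:M).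
  rewrite {trB}; elim: (k) => [|j [u IHj]] /=.
    by exists 0; rewrite -scalar_mx_block.
  rewrite IHj {1}defB mulmx_block !mul0mx !mulmx0 !addr0 !add0r.
  by rewrite exprS scalar_mxM; eexists.
have [u defBk] := powB; rewrite trB defBk mxtrace_block mxtrace_scalar big_cons.
congr (_ + _); apply: IHn; apply: (mulfI (negbT (polyXsubC_eq0 z))).
rewrite -(char_poly_block_mx11 z (dlsubmx B)) -defB char_poly_conj //.
by rewrite Ar big_cons.
Qed.

(** * Determinants: Cauchy-Binet and a rank-one update *)

Lemma det_mulmx_rowsub (R : comNzRingType) m p (A : 'M[R]_(m, p))
    (B : 'M_(p, m)) :
  \det (A *m B) =
  \sum_(f : {ffun 'I_m -> 'I_p}) (\prod_i A i (f i)) * \det (rowsub f B).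
Proof.
pose AB s i j := A i j * B j (s i).
transitivity (\sum_(f : {ffun 'I_m -> 'I_p}) \sum_(s : 'S_m)
    (-1) ^+ s * \prod_i AB s i (f i)).
  rewrite exchange_big; apply: eq_bigr => /= s _; rewrite -big_distrr /=.
  congr (_ * _); rewrite -(bigA_distr_bigA (AB s)) /=.
  by apply: eq_bigr => x _; rewrite mxE.
apply: eq_bigr => f _; rewrite big_distrr /=; apply: eq_bigr => s _.
rewrite mulrCA big_split /=; congr (_ * (_ * _)).
by apply: eq_bigr => x _; rewrite mxE.
Qed.

(* Cauchy-Binet for M M^T; summing over all column choices f rather than over
   increasing ones counts each minor m! times. *)
Lemma det_mulmx_trmx (R : comNzRingType) m p (M : 'M[R]_(m, p)) :
  \sum_(f : {ffun 'I_m -> 'I_p}) \det (colsub f M) ^+ 2 =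
  (m`!)%:R * \det (M *m M^T).
Proof.
have detT (f : 'I_m -> 'I_p) : \det (rowsub f M^T) = \det (colsub f M).
  by rewrite -det_tr; congr (\det _); apply/matrixP => i j; rewrite !mxE.
rewrite det_mulmx_rowsub.
(* The factor [m!] becomes a sum over permutations [s], matched with the Leibniz expansion of one
   factor of each squared minor. For fixed [s], replacing [f] by its composite with [s] permutes the
   columns of the minor, which produces the Leibniz sign. *)
transitivity (\sum_(s : 'S_m) \sum_(f : {ffun 'I_m -> 'I_p})
    (\prod_i M i (f i)) * \det (rowsub f M^T)); last first.
  by rewrite sumr_const card_Sn mulr_natl.
transitivity (\sum_(f : {ffun 'I_m -> 'I_p}) \sum_(s : 'S_m)
    (-1) ^+ s * (\prod_i M i (f (s i))) * \det (colsub f M)).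
  apply: eq_bigr => f _; rewrite expr2 [in LHS]big_distrl /=.
  apply: eq_bigr => s _; congr (_ * _ * _).
  by apply: eq_bigr => i _; rewrite mxE.
rewrite exchange_big /=; apply: eq_bigr => s _.
pose h (t : 'S_m) (f : {ffun 'I_m -> 'I_p}) := [ffun i => f (t i)].
have hK t : cancel (h t) (h t^-1%g).
  by move=> f; apply/ffunP => i; rewrite !ffunE permKV.
have hKV t : cancel (h t^-1%g) (h t).
  by move=> f; apply/ffunP => i; rewrite !ffunE permK.
rewrite [RHS](reindex (h s)) /=; last by apply: onW_bij; exists (h s^-1%g).
apply: eq_bigr => f _; rewrite detT.
have -> : \det (colsub (h s f) M) = (-1) ^+ s * \det (colsub f M).
  have -> : colsub (h s f) M = col_perm s (colsub f M).
    by apply/matrixP => i j; rewrite !mxE ffunE.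
  by rewrite col_permE det_mulmx det_perm odd_permV mulrC.
rewrite mulrCA mulrA; congr (_ * _ * _).
by apply: eq_bigr => i _; rewrite ffunE.
Qed.

(* The Schur complement computation with X^-1 replaced by E = adj X, so that it
   makes sense over a domain, at the price of a factor det X on both sides. *)
Lemma det_diag_rank1 (K : idomainType) n (x u : 'I_n -> K) (c : K) :
  \prod_i x i != 0 ->
  \det (\matrix_(i, j) (x i *+ (i == j) + u i * c)) =
  \prod_i x i + c * \sum_i u i * \prod_(j | j != i) x j.
Proof.
set d := \prod_i x i => d_neq0.
pose X : 'M[K]_n := diag_mx (\row_i x i).
pose E : 'M[K]_n := diag_mx (\row_i \prod_(j | j != i) x j).
pose U : 'cV[K]_n := \col_i u i; pose W : 'rV[K]_n := const_mx c.
have XE : X *m E = d%:M.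
  rewrite mulmx_diag -diag_const_mx; congr diag_mx; apply/rowP => i.
  by rewrite !mxE [RHS](bigD1 i).
have detX : \det X = d.
  by rewrite det_diag; apply: eq_bigr => i _; rewrite mxE.
have -> : \matrix_(i, j) (x i *+ (i == j) + u i * c) = X + U *m W.
  by apply/matrixP => i j; rewrite !mxE big_ord1 !mxE.
have WEU : W *m E *m U = (c * \sum_i u i * \prod_(j | j != i) x j)%:M.
  rewrite [LHS]mx11_scalar; congr _%:M; rewrite !mxE mulr_sumr.
  apply: eq_bigr => i _; rewrite mxE (bigD1 i) //= big1 => [|j ji].
    by rewrite !mxE eqxx addr0 -mulrA [_ * u i]mulrC.
  by rewrite !mxE (negPf ji) mulr0.
(* The block [U] of [B] is cleared in two ways: by rows, which gives [\det B = \det (X + U *m W)],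
   and by columns with [E], which computes [\det B * d]. The nonzero [d] is then cancelled. *)
pose B : 'M[K]_(1 + n) := block_mx 1%:M (- W) U X.
have B1 : block_mx 1%:M 0 (- U) 1%:M *m B = block_mx 1%:M (- W) 0 (X + U *m W).
  rewrite mulmx_block !mul1mx !mul0mx !mulmx1 !addr0 mulNmx mulmxN opprK.
  by rewrite addNr addrC.
have B2 : B *m block_mx d%:M 0 (- (E *m U)) 1%:M =
    block_mx (d + c * \sum_i u i * \prod_(j | j != i) x j)%:M (- W) 0 X.
  rewrite mulmx_block !mulmx0 !mulmx1 !mul1mx !add0r mulNmx !mulmxN opprK.
  by rewrite !mulmxA WEU -raddfD XE mul_mx_scalar mul_scalar_mx subrr.
have /(congr1 determinant) := B1.
rewrite det_mulmx det_lblock det_ublock !det1 !mul1r => detB.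
have /(congr1 determinant) := B2.
rewrite det_mulmx det_lblock det_ublock det1 mulr1 !det_scalar1 detX detB.
exact: mulIf.
Qed.

(** * Centered diagonal matrices and their Gram matrix *)

Lemma deriv_prod_XsubC (R : comNzRingType) n (b : 'I_n -> R) :
  (\prod_i ('X - (b i)%:P))^`() = \sum_i \prod_(j | j != i) ('X - (b j)%:P).
Proof.
elim: n b => [|n IHn] b; first by rewrite !big_ord0 derivC.
rewrite big_ord_recl derivM derivXsubC mul1r IHn big_ord_recl; congr (_ + _).
  by rewrite [RHS]big_mkcond big_ord_recl /= mul1r.
rewrite mulr_sumr; apply: eq_bigr => i _.
by rewrite [RHS]big_mkcond big_ord_recl /= -big_mkcond.
Qed.

(* Used with nu = 1/n; keeping nu as a parameter lets these matrices be mapped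
   along ring morphisms without inverting n in the ring. *)
Definition centering (K : comNzRingType) n (nu : K) : 'M[K]_n :=
  1%:M - const_mx nu.

Definition centered_diag (K : comNzRingType) n (nu : K) (b : 'I_n -> K) :=
  diag_mx (\row_i b i) *m centering n nu.

(** Each S_k is flattened into a row, so that the product with the transpose is the Gram matrix for
    the form tr (A B^T). *)
Definition power_rows (K : comNzRingType) m n (nu : K) (b : 'I_n -> K) :
    'M[K]_(m, n * n) :=
  \matrix_(i < m)
    mxvec (centering n nu *m iter i (mulmx (centered_diag nu b)) 1%:M).

Lemma map_power_rows (K K' : comNzRingType) (f : {rmorphism K -> K'}) m n
    (nu : K) (b : 'I_n -> K) :
  map_mx f (power_rows m nu b) = power_rows m (f nu) (f \o b).
Proof.
have fP : map_mx f (centering n nu) = centering n (f nu).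
  by rewrite map_mxB map_mx1 map_const_mx.
have fD : map_mx f (centered_diag nu b) = centered_diag (f nu) (f \o b).
  rewrite map_mxM fP map_diag_mx; congr (diag_mx _ *m _).
  by apply/rowP => i; rewrite !mxE.
apply/row_matrixP => i; rewrite -map_row !rowK map_mxvec map_mxM fP.
congr (mxvec (_ *m _)); elim: (val i) => [|k IHk] /=; first exact: map_mx1.
by rewrite map_mxM fD IHk.
Qed.

Lemma mulmx_mxvec_tr (K : comNzRingType) m n (A B : 'M[K]_(m, n)) :
  (mxvec A *m (mxvec B)^T) 0 0 = \tr (A *m B^T).
Proof.
rewrite mxE (reindex _ (curry_mxvec_bij _ _)) /=.
transitivity (\sum_i \sum_j A i j * B i j).
  by rewrite pair_bigA; apply: eq_bigr => -[i j] _ /=; rewrite mxE !mxvecE.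
by apply: eq_bigr => i _; rewrite mxE; apply: eq_bigr => j _; rewrite mxE.
Qed.

(** The characteristic matrix is the diagonal matrix of the ['X - b_i] plus a rank-one matrix with
    entries [b_i * nu]. On the other side, writing ['X] as [('X - b_i) + b_i] in each term of ['X]
    times the derivative gives n copies of the product plus the same correction. *)
Lemma char_poly_centered_diag (K : idomainType) n (nu : K) (b : 'I_n -> K) :
  n%:R * nu = 1 ->
  char_poly (centered_diag nu b) =
  nu *: ('X * (\prod_i ('X - (b i)%:P))^`()).
Proof.
move=> nnu; set f := \prod_i _.
have f_neq0 : f != 0 by rewrite monic_neq0 // monic_prod_XsubC.
have -> : char_poly (centered_diag nu b) =
    f + nu%:P * \sum_i (b i)%:P * \prod_(j | j != i) ('X - (b j)%:P).
  rewrite -det_diag_rank1 //; congr (\det _); apply/matrixP => i j.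
  rewrite !mxE (bigD1 i) //= big1 => [|k ki]; last first.
    by rewrite !mxE eq_sym (negPf ki) mul0r.
  rewrite !mxE eqxx addr0; case: (i == j); rewrite /= ?mulr1n ?mulr0n.
    by rewrite mulrBr mulr1 polyCB polyCM opprB addrA addrAC.
  by rewrite !sub0r add0r mulrN polyCN polyCM opprK.
rewrite deriv_prod_XsubC ['X * _]mulr_sumr -mul_polyC.
have -> : \sum_i 'X * \prod_(j | j != i) ('X - (b j)%:P) =
    \sum_(i < n) f + \sum_i (b i)%:P * \prod_(j | j != i) ('X - (b j)%:P).
  rewrite -big_split; apply: eq_bigr => i _ /=.
  by rewrite [f](bigD1 i) //= -mulrDl subrK.
rewrite sumr_const card_ord mulrDr -mulr_natl mulrA -polyC_natr -polyCM.
by rewrite [nu * _]mulrC nnu mul1r.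
Qed.

Lemma gram_power_rows (L : fieldType) m n (nu : L) (b : 'I_n -> L) (r : seq L) :
  n%:R * nu = 1 ->
  (\prod_i ('X - (b i)%:P))^`() = n%:R *: \prod_(z <- r) ('X - z%:P) ->
  forall i j,
  (power_rows m nu b *m (power_rows m nu b)^T) i j = \sum_(z <- r) z ^+ (i + j).
Proof.
move=> nnu fr i j; set C := centered_diag nu b.
have chC : char_poly C = \prod_(z <- 0 :: r) ('X - z%:P).
  rewrite char_poly_centered_diag // fr -scalerAr scalerA [nu * _]mulrC nnu.
  by rewrite scale1r big_cons subr0.
have trC k : \tr (iter k (mulmx C) 1%:M) = 0 ^+ k + \sum_(z <- r) z ^+ k.
  by rewrite (mxtrace_exp_split _ chC) big_cons.
set P := centering n nu; set S := fun k => P *m iter k (mulmx C) 1%:M.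
have PP : P *m P = P.
  have JJ : (const_mx nu : 'M_n) *m (const_mx nu : 'M_n) = const_mx nu.
    apply/matrixP => k l; rewrite !mxE; under eq_bigr do rewrite !mxE.
    by rewrite sumr_const card_ord -mulr_natl mulrA nnu mul1r.
  by rewrite mulmxBl mul1mx mulmxBr mulmx1 JJ subrr subr0.
have PT : P^T = P by rewrite linearB /= trmx1 trmx_const.
have CP k : iter k.+1 (mulmx C) 1%:M *m P = iter k.+1 (mulmx C) 1%:M.
  elim: k => [|k IHk]; first by rewrite /= mulmx1 -mulmxA PP.
  by rewrite iterS -mulmxA IHk.
have SP k : S k *m P = S k.
  by case: k => [|k]; rewrite /S -mulmxA ?CP //= mul1mx mulmx1.
have iterC k l : iter (k + l) (mulmx C) 1%:M =
    iter k (mulmx C) 1%:M *m iter l (mulmx C) 1%:M.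
  by elim: k => [|k IHk]; rewrite ?mul1mx // addSn !iterS IHk mulmxA.
(* Induction from S_(k+1) = P D S_k, whose transpose is S_k D P, again S_(k+1). *)
have ST k : (S k)^T = S k.
  elim: k => [|k IHk]; first by rewrite /S /= mulmx1.
  have SS : S k.+1 = P *m diag_mx (\row_i b i) *m S k.
    by rewrite /S iterS !mulmxA.
  rewrite SS trmx_mul IHk trmx_mul PT tr_diag_mx -SS -[diag_mx _ *m P]/C /S.
  by rewrite -(addn1 k) iterC /= mulmx1 mulmxA.
have trS k : \tr (S k) = \sum_(z <- r) z ^+ k.
  (* For k = 0 the extra root 0 of [char_poly C] contributes 0^0 = 1, which the trace 1 of
     [const_mx nu] removes. *)
  rewrite /S mxtrace_mulC; case: k => [|k].
    rewrite mul1mx /P raddfB /= mxtrace1.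
    have := trC 0; rewrite /= mxtrace1 expr0 => ->.
    suff -> : \tr (const_mx nu : 'M_n) = 1 by rewrite addrAC subrr add0r.
    rewrite /mxtrace; under eq_bigr do rewrite mxE.
    by rewrite sumr_const card_ord -mulr_natl.
  by rewrite CP trC expr0n add0r.
have -> : (power_rows m nu b *m (power_rows m nu b)^T) i j =
    \tr (S i *m (S j)^T).
  by rewrite -mulmx_mxvec_tr !mxE; apply: eq_bigr => k _; rewrite !mxE.
by rewrite ST -[RHS]trS /S iterC !mulmxA -/(S i) SP.
Qed.

(** * The discriminant of the derivative over a field *)

Lemma size_lead_coef_deriv_prod (K : idomainType) n (a : 'I_n.+1 -> K) :
  n.+1%:R != 0 :> K ->
  let p := (\prod_i ('X - (a i)%:P))^`() in
  size p = n.+1 /\ lead_coef p = n.+1%:R.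
Proof.
move=> n_neq0; set F := \prod_i _; move=> p.
have size_F : size F = n.+2.
  by rewrite /F -big_enum /= size_prod_XsubC size_enum_ord.
have pn : p`_n = n.+1%:R.
  rewrite coef_deriv; have := monic_prod_XsubC (index_enum _) predT a.
  by rewrite monicE lead_coefE -/F size_F => /eqP ->.
suff size_p : size p = n.+1 by rewrite lead_coefE size_p.
apply/eqP; rewrite eqn_leq -ltnS -[in X in (_ < X)%N]size_F lt_size_deriv.
  by rewrite ltnNge; apply: contra_neqN n_neq0 => /(nth_default 0) <-.
by rewrite -size_poly_eq0 size_F.
Qed.

Lemma size_roots_deriv (L : fieldType) n (nu : L) (a : 'I_n.+1 -> L)
    (r : seq L) :
  n.+1%:R * nu = 1 ->
  (\prod_i ('X - (a i)%:P))^`() = n.+1%:R *: \prod_(z <- r) ('X - z%:P) ->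
  size r = n.
Proof.
move=> nnu fr; have n_neq0 : n.+1%:R != 0 :> L.
  by apply: contra_eq_neq nnu => ->; rewrite mul0r eq_sym oner_eq0.
have [sf _] := size_lead_coef_deriv_prod a n_neq0.
by apply: succn_inj; rewrite -sf fr size_scale // (size_prod_XsubC r id).
Qed.

Lemma prod_sqr_sub_gram (L : fieldType) n (nu : L) (a : 'I_n.+1 -> L) (c : L)
    (r : seq L) :
  n.+1%:R * nu = 1 ->
  (\prod_i ('X - (a i)%:P))^`() = n.+1%:R *: \prod_(z <- r) ('X - z%:P) ->
  let M := power_rows n nu (fun i => a i - c) in
  \prod_(j < size r) \prod_(i < j) (r`_i - r`_j) ^+ 2 = \det (M *m M^T).
Proof.
move=> nnu fr M.
have sr := size_roots_deriv nnu fr.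
have fr' : (\prod_i ('X - (a i - c)%:P))^`() =
    n.+1%:R *: \prod_(z <- [seq z - c | z <- r]) ('X - z%:P).
  (* Composition with ['X + c] commutes with derivation and translates all roots by [- c]. *)
  have shift z : ('X - z%:P) \Po ('X + c%:P) = 'X - (z - c)%:P.
    by rewrite comp_polyB comp_polyX comp_polyC polyCB opprB addrA addrAC.
  have /(congr1 (comp_poly ('X + c%:P))) := fr.
  rewrite comp_polyZ !rmorph_prod big_map /=.
  under [in RHS]eq_bigr do rewrite shift.
  move=> <-; under eq_bigr do rewrite -shift.
  by rewrite -rmorph_prod deriv_comp derivD derivX derivC addr0 mulr1.
pose V := Vandermonde n (\row_(j < n) (r`_j - c)).
have -> : M *m M^T = V *m V^T.
  apply/matrixP => i j; rewrite (gram_power_rows nnu fr') mxE big_map.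
  rewrite (big_nth 0) sr big_mkord; apply: eq_bigr => k _.
  by rewrite !mxE exprD.
rewrite det_mulmx det_tr -expr2 det_Vandermonde sr -prodrXl.
under [RHS]eq_bigr do rewrite -prodrXl.
(* The Vandermonde product has the smaller index outside, [disc_of_roots] the larger one. *)
rewrite (exchange_big_dep predT) //=; apply: eq_bigr => j _.
rewrite (big_ord_widen n (fun i => (r`_i - r`_j) ^+ 2)) 1?ltnW //.
apply: eq_bigr => i _; rewrite !mxE -sqrrN; congr (_ ^+ 2).
by rewrite !opprB addrA subrK.
Qed.

(** * The generic polynomial and the sum of squares *)

Lemma splits_with_exists (A : idomainType) (p : {poly A}) : p != 0 ->
  exists (L : fieldType) (iota : {rmorphism A -> L}) (r : seq L),
    injective iota /\ splits_with iota p r.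
Proof.
move=> p_neq0; have tofrac_inj : injective (@tofrac A).
  by move=> x y /eqP; rewrite tofrac_eq => /eqP.
have q_neq0 : map_poly (@tofrac A) p != 0.
  rewrite -(rmorph0 (map_poly (@tofrac A))).
  by rewrite (inj_eq (map_inj_poly tofrac_inj (rmorph0 _))).
have [L [iota [r qr]]] := exists_splitting_extension q_neq0.
exists L, (iota \o @tofrac A), r; split.
  exact: inj_comp (fmorph_inj iota) tofrac_inj.
rewrite /splits_with map_poly_comp /= qr; congr (iota _ *: _).
by rewrite lead_coef_map_inj // rmorph0.
Qed.

Lemma lead_coef_deriv_generic_poly (R : realType) n (c : R) :
  lead_coef (generic_poly n.+1 c)^`() = (c * n.+1%:R)%:MP.
Proof.
have n_neq0 : n.+1%:R != 0 :> {mpoly R[n.+1]}.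
  by rewrite -(rmorph_nat (@mpolyC n.+1 R)) mpolyC_eq0 pnatr_eq0.
have [_ lF] :=
  size_lead_coef_deriv_prod (fun i => 'X_i : {mpoly R[n.+1]}) n_neq0.
by rewrite /generic_poly derivZ lead_coefZ lF rmorphM /= rmorph_nat.
Qed.

(** [M] has its entries in the polynomial ring itself, so the Gram identity in every field [L] is
    the image of one and the same element. *)
Lemma is_discriminant_deriv_generic_poly (R : realType) n (c : R) : c != 0 ->
  let M : 'M[{mpoly R[n.+1]}]_(n, n.+1 * n.+1) :=
    power_rows n (n.+1%:R^-1)%:MP (fun i => 'X_i - 'X_0) in
  is_discriminant (generic_poly n.+1 c)^`()
    ((c * n.+1%:R)%:MP ^+ (2 * n - 2) * \det (M *m M^T)).
Proof.
move=> c_neq0 M; have lp := lead_coef_deriv_generic_poly n c.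
have cn_neq0 : c * n.+1%:R != 0 by rewrite mulf_neq0 // pnatr_eq0.
split; first by apply: splits_with_exists; rewrite -lead_coef_eq0 lp mpolyC_eq0.
move=> L iota r iota_inj; rewrite /splits_with /disc_of_roots lp => pr.
have nu1 : n.+1%:R * iota (n.+1%:R^-1)%:MP = 1.
  rewrite -(rmorph_nat iota) -(rmorph_nat (@mpolyC n.+1 R)) -!rmorphM /=.
  by rewrite mulfV ?pnatr_eq0 // !rmorph1.
have fr : (\prod_i ('X - (iota 'X_i)%:P))^`() =
    n.+1%:R *: \prod_(z <- r) ('X - z%:P).
  have ic_neq0 : iota c%:MP != 0.
    by rewrite -(rmorph0 iota) (inj_eq iota_inj) mpolyC_eq0.
  apply: (scalerI ic_neq0); rewrite scalerA.
  have -> : iota c%:MP * n.+1%:R = iota (c * n.+1%:R)%:MP.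
    by rewrite !rmorphM /= !rmorph_nat.
  rewrite -pr -deriv_map /generic_poly map_polyZ rmorph_prod derivZ.
  by congr (_ *: _); under [in RHS]eq_bigr do rewrite /= map_polyXsubC.
rewrite (prod_sqr_sub_gram (iota 'X_0) nu1 fr) (size_roots_deriv nu1 fr).
rewrite rmorphM rmorphXn /=.
congr (_ * _); rewrite -det_map_mx map_mxM -map_trmx map_power_rows.
rewrite (_ : iota \o _ = fun i => iota 'X_i - iota 'X_0) //.
by apply: funext => i /=; rewrite rmorphB.
Qed.

Theorem corollary14 (R : realType) (n : nat) (c : R)
    (hn : (2 <= n)%N) (hc : c != 0) :
  exists s : seq {mpoly R[#|{: 'I_n * 'I_n}|]},
    is_discriminant (generic_poly n c)^`()
      (\sum_(q <- s) (q \mPo root_differences R n) ^+ 2).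
Proof.
case: n hn => [|m] // _; set N := #|_|.
have := is_discriminant_deriv_generic_poly m hc.
set M := power_rows _ _ _ => dM.
pose nu : R := m.+1%:R^-1.
(* [Y] lifts [M]: the variable attached to the pair (i, 0) stands for a_i - a_0. *)
pose Y : 'M[{mpoly R[N]}]_(m, m.+1 * m.+1) :=
  power_rows m nu%:MP (fun i => 'X_(enum_rank (i, 0))).
pose phi : {rmorphism {mpoly R[N]} -> {mpoly R[m.+1]}} :=
  comp_mpoly (root_differences R m.+1).
have phiC a : phi a%:MP = a%:MP by exact: comp_mpolyC.
have phiY : map_mx phi Y = M.
  rewrite map_power_rows phiC; congr power_rows; apply: funext => i /=.
  by rewrite comp_mpolyXU -tnth_nth tnth_mktuple enum_rankK.
(* The power of the leading coefficient has even exponent, and the real square root absorbs the [m!]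
   of Cauchy-Binet, so both enter the squares through [k]. *)
pose k := (c * m.+1%:R) ^+ m.-1 * Num.sqrt ((m`!)%:R^-1).
have k2 : k ^+ 2 * (m`!)%:R = (c * m.+1%:R) ^+ (2 * m - 2).
  rewrite exprMn sqr_sqrtr ?invr_ge0 ?ler0n // mulfVK; last first.
    by rewrite pnatr_eq0 -lt0n fact_gt0.
  by rewrite -exprM mulnC -subn1 mulnBr muln1.
exists [seq k%:MP * \det (colsub f Y) | f : {ffun 'I_m -> 'I_(m.+1 * m.+1)}].
rewrite big_image /=.
suff -> : \sum_(f : {ffun 'I_m -> 'I_(m.+1 * m.+1)})
    (k%:MP * \det (colsub f Y) \mPo root_differences R m.+1) ^+ 2 =
    (c * m.+1%:R)%:MP ^+ (2 * m - 2) * \det (M *m M^T) by [].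
have -> : (c * m.+1%:R)%:MP ^+ (2 * m - 2) =
    k%:MP ^+ 2 * (m`!)%:R :> {mpoly R[m.+1]}.
  by rewrite -rmorphXn -k2 rmorphM rmorphXn /= rmorph_nat.
rewrite -mulrA -det_mulmx_trmx mulr_sumr; apply: eq_bigr => f _.
rewrite -[_ \mPo _]/(phi _) rmorphM phiC -det_map_mx map_mxsub phiY.
exact: exprMn.
Qed.
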